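(* For every $n\ge 4$, the complete graph $K_n$ does not belong to $\mathcal{S}ymm$; that is, $\mathcal{B}$ has no symmetric strategy on $K_n$.
   Context: All graphs are finite simple graphs. Given a graph $G$, two players $\mathcal{A}$ and $\mathcal{B}$ alternately color edges of $G$, $\mathcal{A}$ in red and $\mathcal{B}$ in blue, with $\mathcal{A}$ moving first; in each move a player colors one so-far uncolored edge. The $i$-th round consists of the $i$-th move of $\mathcal{A}$ followed by the $i$-th move of $\mathcal{B}$. A strategy for a player is a function assigning to each sequence of the opponent's previous moves a legal (uncolored) edge to color next. Let $A_i$ (resp. $B_i$) be the set of red (resp. blue) edges colored in the first $i$ rounds. A symmetric strategy of $\mathcal{B}$ on $G$ is a strategy of $\mathcal{B}$ ensuring that, irrespective of $\mathcal{A}$'s strategy, the subgraphs with edge sets $A_i$ and $B_i$ are isomorphic for every $i\le m/2$, where $m$ is the number of edges of $G$. $\mathcal{S}ymm$ denotes the class of all graphs on which $\mathcal{B}$ has a symmetric strategy. *)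

(* Defs.v *)
From mathcomp Require Import all_boot.

Set Implicit Arguments.
Unset Strict Implicit.
Unset Printing Implicit Defensive.

Record sgraph := SGraph {
  vertex :> finType;
  adj : rel vertex;
  adj_sym : symmetric adj;
  adj_irrefl : irreflexive adj }.

Definition edges (G : sgraph) : {set {set G}} :=
  [set [set p.1; p.2] | p in [set p : G * G | adj p.1 p.2]].

Definition isomorphic (G H : sgraph) : Prop :=
  exists2 f : G -> H, bijective f & forall x y, adj (f x) (f y) = adj x y.

Section Subgraph.
Variables (G : sgraph) (F : {set {set G}}).

Definition subgraph_adj : rel G := fun x y => adj x y && ([set x; y] \in F).

Lemma subgraph_adj_sym : symmetric subgraph_adj.
Proof. by move=> x y; rewrite /subgraph_adj adj_sym setUC. Qed.

Lemma subgraph_adj_irrefl : irreflexive subgraph_adj.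
Proof. by move=> x; rewrite /subgraph_adj adj_irrefl. Qed.

(* The spanning subgraph with edge set F.  Isomorphism of two spanning
   subgraphs of the same finite graph amounts to isomorphism of the subgraphs
   without isolated vertices having the same edge sets. *)
Definition subgraph : sgraph := SGraph subgraph_adj_sym subgraph_adj_irrefl.

End Subgraph.

Section Game.
Variable G : sgraph.
Local Notation edge := {set G}.

(* Maps the sequence of the opponent's previous moves, oldest first, to the
   player's next move; legality is imposed separately below. *)
Definition strategy := seq edge -> edge.

(* The edges coloured when a player following the strategy is to move, given
   the opponent's moves so far.  Player A has already answered each proper
   prefix of [bs]; player B, moving second, has answered each nonempty proper
   prefix of [s]. *)
Definition colouredA (sA : strategy) (bs : seq edge) : seq edge :=
  bs ++ [seq sA (take i bs) | i <- iota 0 (size bs)].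

Definition colouredB (sB : strategy) (s : seq edge) : seq edge :=
  s ++ [seq sB (take i s) | i <- iota 1 (size s).-1].

(* The coloured edges form a position that can be reached: they are distinct
   edges of G. *)
Definition position (c : seq edge) : Prop := uniq c /\ {subset c <= edges G}.

(* An edge must be supplied only while an uncoloured one is left. *)
Definition legal_move (c : seq edge) (e : edge) : Prop :=
  size c < #|edges G| -> e \in edges G /\ e \notin c.

Definition strategy_of_A (sA : strategy) : Prop :=
  forall bs, position (colouredA sA bs) -> legal_move (colouredA sA bs) (sA bs).

Definition strategy_of_B (sB : strategy) : Prop :=
  forall s, s != [::] ->
    position (colouredB sB s) -> legal_move (colouredB sB s) (sB s).

(* The moves of A and of B in the first i rounds, oldest first. *)
Fixpoint play (sA sB : strategy) (i : nat) : seq edge * seq edge :=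
  if i is j.+1 then
    let: (ra, rb) := play sA sB j in
    let ra' := rcons ra (sA rb) in
    (ra', rcons rb (sB ra'))
  else ([::], [::]).

Definition red (sA sB : strategy) (i : nat) : {set edge} :=
  [set e in (play sA sB i).1].

Definition blue (sA sB : strategy) (i : nat) : {set edge} :=
  [set e in (play sA sB i).2].

Definition symmetric_strategy (sB : strategy) : Prop :=
  strategy_of_B sB /\
  forall sA, strategy_of_A sA ->
  forall i, i.*2 <= #|edges G| ->
    isomorphic (subgraph (red sA sB i)) (subgraph (blue sA sB i)).

End Game.

Definition Symm (G : sgraph) : Prop :=
  exists sB : strategy G, symmetric_strategy sB.

Section Complete.
Variable n : nat.

Definition complete_adj : rel 'I_n := fun x y => x != y.

Lemma complete_adj_sym : symmetric complete_adj.
Proof. by move=> x y; rewrite /complete_adj eq_sym. Qed.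

Lemma complete_adj_irrefl : irreflexive complete_adj.
Proof. by move=> x; rewrite /complete_adj eqxx. Qed.

Definition complete_graph : sgraph :=
  SGraph complete_adj_sym complete_adj_irrefl.

End Complete.

(* Main.v *)
Require Import Defs.
From mathcomp Require Import all_boot.

Set Implicit Arguments.
Unset Strict Implicit.
Unset Printing Implicit Defensive.

(** After the first round A picks an end [a] of its edge [ab] that is missed by
    the blue edge, and a vertex [c != b] of the blue edge, and colours [ac].
    The blue graph must now be a path of length two, with midpoint [p].  If
    [ap] is blue, then [ac] cannot complete a blue triangle, so A wins by
    closing the red triangle [abc].  Otherwise A colours [ap], unless it is red
    already, and goes on colouring edges at [a].  The blue graph must remain a
    star with centre [p]; as [ap] is red, it never reaches [a], so that the red
    star becomes spanning, whereas no blue star can be spanning any more. *)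

Lemma iotaSr m n : iota m n.+1 = rcons (iota m n) (m + n).
Proof. by rewrite -addn1 iotaD cats1. Qed.

Lemma map_take_rcons (T U : Type) (f : seq T -> U) s x m k :
    m + k <= (size s).+1 ->
  [seq f (take i (rcons s x)) | i <- iota m k] =
  [seq f (take i s) | i <- iota m k].
Proof.
move=> le_mk; apply/eq_in_map => i; rewrite mem_iota => /andP[_ lt_i].
by rewrite -cats1 takel_cat // -ltnS (leq_trans lt_i).
Qed.

Lemma mem_neq_set (T : finType) (x : T) (A B : {set T}) :
  x \in A -> x \notin B -> A != B.
Proof. by move=> xA; apply: contraNneq => <-. Qed.

(** * Playing a fixed sequence of moves against a strategy of B *)

Section OpenLoop.
Variables (G : sgraph) (sB : strategy G).
Local Notation edge := {set G}.

(** Prefixes start at length 1 since B moves second; the answer to [s] itself is included, so the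
    round is complete. *)
Definition replies (s : seq edge) : seq edge :=
  [seq sB (take i s) | i <- iota 1 (size s)].

Lemma size_replies s : size (replies s) = size s.
Proof. by rewrite size_map size_iota. Qed.

Lemma replies_rcons s e :
  replies (rcons s e) = rcons (replies s) (sB (rcons s e)).
Proof.
rewrite /replies size_rcons iotaSr map_rcons map_take_rcons ?add1n //.
by rewrite take_oversize ?size_rcons.
Qed.

Lemma colouredB_rcons s e :
  colouredB sB (rcons s e) = rcons s e ++ replies s.
Proof. by rewrite /colouredB size_rcons /= map_take_rcons. Qed.

(* A sequence of moves that A can make, one after the other, against [sB]. *)
Definition line (s : seq edge) : Prop := position (s ++ replies s).

Lemma line_rcons s e :
    strategy_of_B sB -> line s -> (size s).+1.*2 <= #|edges G| ->
    e \in edges G -> e \notin s ++ replies s ->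
  line (rcons s e).
Proof.
move=> sBP [Us sE] szs eE eN.
have pos : position (rcons s e ++ replies s).
  rewrite cat_rcons; split.
    by rewrite -cat1s uniq_catCA cat1s /= eN.
  move=> x; rewrite mem_cat inE orbCA -mem_cat.
  by case/predU1P => [->|/sE].
have := sBP (rcons s e); rewrite /legal_move colouredB_rcons.
case=> //; first by rewrite -size_eq0 size_rcons.
  by rewrite size_cat size_rcons size_replies addSn addnn -doubleS.
move=> bE bN; rewrite /line replies_rcons.
rewrite -rcons_cat; case: pos => U sub; split; first by rewrite rcons_uniq bN.
by move=> x; rewrite mem_rcons inE => /predU1P[->|/sub].
Qed.

Section Realise.
Variable s : seq edge.

(** The default of [odflt] is reached only when [c] exhausts the edges, where legality demands
    nothing. *)
Definition free_edge (c : seq edge) (e : edge) : edge :=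
  if (e \in edges G) && (e \notin c) then e
  else odflt e [pick x in edges G | x \notin c].

Lemma free_edge_legal c e : legal_move c (free_edge c e).
Proof.
move=> szc; rewrite /free_edge; case: ifP => [/andP[]|_] //.
case: pickP => [x /andP[]|none] //=.
suff : #|edges G| <= size c by rewrite leqNgt szc.
apply: leq_trans (card_size c); apply/subset_leq_card/subsetP => x xE.
by have := none x; rewrite xE /= => /negbFE.
Qed.

(* The answers of A that precede its answer to [rev rb]. *)
Fixpoint answers (rb : seq edge) : seq edge :=
  if rb is _ :: rb' then
    let h := answers rb' in
    rcons h (free_edge (rev rb' ++ h) (nth set0 s (size rb')))
  else [::].

(* Falling back on an arbitrary uncoloured edge keeps the strategy legal against
   opponents that deviate from [sB]. *)
Definition line_strategy : strategy G := fun bs =>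
  free_edge (bs ++ answers (rev bs)) (nth set0 s (size bs)).

Lemma colouredA_line_strategy bs :
  colouredA line_strategy bs = bs ++ answers (rev bs).
Proof.
rewrite /colouredA; congr cat.
elim/last_ind: bs => [//|bs b IH].
rewrite size_rcons iotaSr map_rcons add0n map_take_rcons ?add0n // IH.
rewrite rev_rcons /=; congr rcons.
by rewrite -cats1 take_size_cat // revK /line_strategy size_rev.
Qed.

Lemma line_strategyP : strategy_of_A line_strategy.
Proof.
by move=> bs _; rewrite colouredA_line_strategy; apply: free_edge_legal.
Qed.

(** Along a line the fallback never occurs, the scheduled edge being still uncoloured. The second
    conjunct carries the induction: the history that A recomputes from the replies is the real
    one. *)
Lemma play_line_strategy i : line s -> i <= size s ->
  play line_strategy sB i = (take i s, replies (take i s)) /\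
  answers (rev (replies (take i s))) = take i s.
Proof.
move=> [Us sE]; elim: i => [|i IH] lt_i; first by rewrite take0.
have [/= -> ans] := IH (ltnW lt_i).
have szi : size (take i s) = i by rewrite size_takel // ltnW.
have take_i : take i.+1 s = rcons (take i s) (nth set0 s i).
  by rewrite (take_nth set0).
have free : free_edge (replies (take i s) ++ take i s) (nth set0 s i)
    = nth set0 s i.
  have iE : nth set0 s i \in edges G by rewrite sE // mem_cat mem_nth.
  rewrite /free_edge iE /=.
  suff /negPf-> : nth set0 s i \notin replies (take i s) ++ take i s by [].
  rewrite mem_cat negb_or; apply/andP; split; last first.
    move: Us; rewrite cat_uniq => /and3P[Us _ _].
    by move: (take_uniq i.+1 Us); rewrite take_i rcons_uniq => /andP[].
  (* An answer to a prefix of [take i s] is also one of [replies s], which is disjoint from [s]. *)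
  apply: contraL (mem_nth set0 lt_i) => inr.
  move: Us; rewrite cat_uniq => /and3P[_ /hasPn N _]; apply: N.
  case/mapP: inr => j; rewrite mem_iota szi => /andP[j0 ltj] ->.
  apply/mapP; exists j; last by rewrite take_takel // -ltnS -add1n.
  by rewrite mem_iota j0 (leq_trans ltj) // add1n ltnS ltnW.
have -> : line_strategy (replies (take i s)) = nth set0 s i.
  by rewrite /line_strategy ans size_replies szi.
rewrite take_i replies_rcons; split=> //.
by rewrite rev_rcons /= ans revK size_rev size_replies szi free.
Qed.

End Realise.

(** Replaces strategies of A by mere sequences of moves, since [line_strategy s] realises [s]. *)
Lemma line_iso s :
    symmetric_strategy sB -> line s -> (size s).*2 <= #|edges G| ->
  isomorphic (subgraph [set e in s]) (subgraph [set e in replies s]).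
Proof.
move=> [_ iso] ls szs; have := iso _ (@line_strategyP s) _ szs.
rewrite /red /blue; have [-> _] := play_line_strategy ls (leqnn _).
by rewrite take_size.
Qed.

End OpenLoop.

(** * Graph properties carried over by an isomorphism *)

Section Isomorphic.
Variables (G : sgraph) (F F' : {set {set G}}).
Hypothesis isoF : isomorphic (subgraph F) (subgraph F').

Lemma edgesP (e : {set G}) :
  reflect (exists x y, adj x y /\ e = [set x; y]) (e \in edges G).
Proof.
apply: (iffP imsetP) => [[[x y]] | [x [y [xy ->]]]].
  by rewrite inE => xy ->; exists x, y.
by exists (x, y); rewrite ?inE.
Qed.

(** The new centre is the image of [a]. Members of [F'] must be edges to be seen by the adjacency of
    the subgraph. *)
Lemma isomorphic_star (a : G) :
    {subset F' <= edges G} -> (forall e, e \in F -> a \in e) ->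
  exists p : G, forall e, e \in F' -> p \in e.
Proof.
case: isoF => f [g fK gK] adj_f sF' star_a; exists (f a) => e eF'.
have [x [y [xy def_e]]] := edgesP _ (sF' e eF').
have : @adj (subgraph F') (f (g x)) (f (g y)).
  by rewrite !gK /= /subgraph_adj xy -def_e.
rewrite adj_f => /andP[_ /star_a].
by rewrite def_e !inE => /pred2P[] ->; rewrite gK eqxx ?orbT.
Qed.

Lemma isomorphic_universal (a : G) :
    (forall x, x != a -> @adj (subgraph F) a x) ->
  exists p : G, forall x, x != p -> @adj (subgraph F') p x.
Proof.
case: isoF => f [g fK gK] adj_f univ_a; exists (f a) => x x_fa.
rewrite -[x]gK adj_f univ_a //.
by apply: contraNneq x_fa => <-; rewrite gK.
Qed.

(** The property is being a disjoint union of cliques; it holds for a triangle with isolated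
    vertices. *)
Lemma isomorphic_cluster :
    (forall x y z, x != z -> @adj (subgraph F) x y -> @adj (subgraph F) y z ->
       @adj (subgraph F) x z) ->
  forall x y z, x != z -> @adj (subgraph F') x y -> @adj (subgraph F') y z ->
    @adj (subgraph F') x z.
Proof.
case: isoF => f [g fK gK] adj_f cl x y z xz.
rewrite -[x]gK -[y]gK -[z]gK !adj_f; apply: cl.
by apply: contra_neq xz => /(can_inj gK).
Qed.

End Isomorphic.

(** * The winning play of A on the complete graph *)

Section CompleteGraph.
Variable n : nat.
Local Notation K := (complete_graph n).

Lemma edges_complete (e : {set K}) : (e \in edges K) = (#|e| == 2).
Proof.
apply/edgesP/cards2P => -[x [y [xy ->]]]; by exists x, y.
Qed.

Lemma set2_edge (x y : K) : ([set x; y] \in edges K) = (x != y).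
Proof. by rewrite edges_complete cards2; case: (x == y). Qed.

Lemma card_edges_complete : #|edges K| = 'C(n, 2).
Proof.
rewrite -[n in RHS]card_ord -card_draws; apply: eq_card => e.
by rewrite edges_complete inE.
Qed.

Lemma edge_eq_set2 (e : {set K}) x y :
  e \in edges K -> x != y -> x \in e -> y \in e -> e = [set x; y].
Proof.
rewrite edges_complete => /eqP e2 xy xe ye; apply/esym/eqP.
by rewrite eqEcard cards2 xy e2 andbT subUset !sub1set xe.
Qed.

Lemma edges_meet_uniq (e1 e2 : {set K}) x y :
    e1 \in edges K -> e2 \in edges K -> e1 != e2 ->
    x \in e1 -> x \in e2 -> y \in e1 -> y \in e2 ->
  x = y.
Proof.
move=> E1 E2 ne x1 x2 y1 y2; apply: contraNeq ne => xy.
by rewrite (edge_eq_set2 E1 xy) // (edge_eq_set2 E2 xy).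
Qed.

(** A spanning star has [n.-1] edges, so A can finish one while symmetry is still required. *)
Lemma double_pred_leq_bin2 : 4 <= n -> (n.-1).*2 <= 'C(n, 2).
Proof.
case: n => // k k4; rewrite bin2 /= -divn2 leq_divRL // -muln2.
by rewrite -mulnA mulnC leq_mul2r; apply/orP; right.
Qed.

Variable sB : strategy K.
Hypotheses (n4 : 4 <= n) (symB : symmetric_strategy sB).

(** The star phase: [e1] and [e2] fix the blue centre [p], and the red edge [ap] keeps blue away
    from [a]. Induction on [n - size s] as A extends its star. *)
Lemma linked_star_absurd s (a p : K) e1 e2 :
    line sB s -> (size s).*2 <= #|edges K| ->
    (forall e, e \in s -> a \in e) -> [set a; p] \in s ->
    e1 \in replies sB s -> e2 \in replies sB s -> e1 != e2 ->
    p \in e1 -> p \in e2 ->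
  False.
Proof.
have [k] := ubnP (n - size s); elim: k s => // k IH s lt_k ls szs sa ap r1 r2.
move=> ne p1 p2.
have iso := line_iso symB ls szs.
have [Us sE] := ls.
have red_blue e : e \in s -> e \in replies sB s -> False.
  move=> es er; move: Us; rewrite cat_uniq => /and3P[_ /hasPn N _].
  by have := N e er; rewrite /= es.
have E1 : e1 \in edges K by apply: sE; rewrite mem_cat r1 orbT.
have E2 : e2 \in edges K by apply: sE; rewrite mem_cat r2 orbT.
have pa : p != a.
  by rewrite eq_sym -set2_edge; apply: sE; rewrite mem_cat ap.
case: (pickP (fun y => (y != a) && ([set a; y] \notin s))); last first.
  move=> all_a.
  have red_a (x : K) : x != a -> [set a; x] \in s.
    by move=> xa; have := all_a x; rewrite xa => /negbFE.
  have [|q blue_q] := @isomorphic_universal _ _ _ iso a.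
    move=> x xa; rewrite /= /subgraph_adj /= /complete_adj eq_sym xa /=.
    by rewrite inE red_a.
  have blueE x : x != q -> [set q; x] \in replies sB s.
    by move/blue_q => /andP[_]; rewrite inE.
  (* A spanning blue star at [q] contains [ap] if [q = a], and [aq] otherwise; both are red. *)
  have [qa|qa] := eqVneq q a.
    by apply: (red_blue _ ap); rewrite -qa blueE // qa.
  by apply: (red_blue _ (red_a _ qa)); rewrite setUC blueE // eq_sym.
move=> y /andP[ya yN].
have [e|e|q blue_q] := @isomorphic_star _ _ _ iso a.
- by rewrite inE => er; apply: sE; rewrite mem_cat er orbT.
- by rewrite inE; apply: sa.
have qp : q = p.
  by apply: (edges_meet_uniq E1 E2 ne) => //; apply: blue_q; rewrite inE.
(* If [ay] were blue it would contain [p], forcing [y = p]; but [ap] is red and [ay] is not. *)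
have eN : [set a; y] \notin s ++ replies sB s.
  rewrite mem_cat negb_or yN; apply/negP => er.
  have := blue_q [set a; y]; rewrite inE qp !inE => /(_ er)/pred2P[pa'|py].
    by rewrite pa' eqxx in pa.
  by rewrite -py ap in yN.
have eE : [set a; y] \in edges K by rewrite set2_edge eq_sym.
(* Red edges are distinct values of [x |-> ax] over the [n.-1] vertices other than [a]. *)
have sza : size (rcons s [set a; y]) <= n.-1.
  rewrite -[n in n.-1]card_ord -(cardC1 (a : 'I_n)).
  rewrite -(size_image (fun x => [set a; x])); apply: uniq_leq_size.
    rewrite rcons_uniq yN.
    by move: Us; rewrite cat_uniq => /andP[].
  move=> e; rewrite mem_rcons inE => /predU1P[->|es].
    by apply/imageP; exists y.
  have eE' : e \in edges K by apply: sE; rewrite mem_cat es.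
  have [x [z [xz def_e]]] := edgesP _ eE'.
  have := sa e es; rewrite def_e !inE => /pred2P[] ->.
    by apply/imageP; exists z; rewrite // !inE eq_sym.
  by apply/imageP; exists x; rewrite // setUC.
have szs' : (size s).+1.*2 <= #|edges K|.
  rewrite card_edges_complete (leq_trans _ (double_pred_leq_bin2 n4)) //.
  by rewrite leq_double -(size_rcons s [set a; y]).
have [sBP _] := symB.
apply: (IH (rcons s [set a; y])).
- have lt_s : size s < n.
    by rewrite -(size_rcons s [set a; y]) (leq_trans sza) ?leq_pred.
  by rewrite size_rcons -ltnS subnSK.
- exact: line_rcons.
- by rewrite size_rcons.
- move=> e; rewrite mem_rcons inE => /predU1P[->|/sa //].
  by rewrite !inE eqxx.
- by rewrite mem_rcons inE ap orbT.
- by rewrite replies_rcons mem_rcons inE r1 orbT.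
- by rewrite replies_rcons mem_rcons inE r2 orbT.
- exact: ne.
- exact: p1.
- exact: p2.
Qed.

Lemma complete_not_symmetric : False.
Proof.
have [sBP _] := symB.
(* Six edges allow the three full rounds of the opening. *)
have six : 6 <= #|edges K|.
  rewrite card_edges_complete (leq_trans _ (double_pred_leq_bin2 n4)) //.
  by move: n4; case: (n) => [|[|[|[|k]]]] // _; rewrite leq_double.
pose u : K := Ordinal (leq_trans (isT : 0 < 4) n4).
pose v : K := Ordinal (leq_trans (isT : 1 < 4) n4).
have start x y : x != y -> line sB [:: [set x; y]].
  move=> xy; apply: (@line_rcons _ _ [::]); rewrite ?set2_edge //.
  by apply: leq_trans six.
(* The reply differs from [uv], so it cannot contain both ends. *)
have [a [b [ab aN]]] : exists a b, a != b /\ a \notin sB [:: [set a; b]].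
  have [U1 sE1] := start u v isT.
  have [ue1|] := boolP (u \in sB [:: [set u; v]]); last by exists u, v.
  exists v, u; split=> //; rewrite (setUC [set v]).
  apply: contraTN U1 => ve1; rewrite /= /replies /=.
  suff -> : sB [:: [set u; v]] = [set u; v] by rewrite inE eqxx.
  by apply: edge_eq_set2 => //; apply: sE1; rewrite !inE eqxx orbT.
have l1 := start a b ab.
pose s1 : seq {set K} := [:: [set a; b]].
pose e1 := sB s1.
have E1 : e1 \in edges K by case: l1 => _; apply; rewrite !inE eqxx orbT.
have [c ce1 cb] : exists2 c, c \in e1 & c != b.
  have [x [y [xy ->]]] := edgesP _ E1.
  have [xb|xb] := eqVneq x b; last by exists x; rewrite ?inE ?eqxx.
  by exists y; rewrite ?inE ?eqxx ?orbT // -xb eq_sym.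
have e1_neq_a x : x \in e1 -> x != a by move=> xe; apply: contraTneq xe => ->.
have ca : c != a by apply: e1_neq_a.
pose s2 : seq {set K} := rcons s1 [set a; c].
have l2 : line sB s2.
  apply: line_rcons; rewrite ?set2_edge 1?eq_sym //.
    by apply: leq_trans six.
  rewrite !inE negb_or; apply/andP; split.
    by apply: (@mem_neq_set _ c); rewrite !inE ?eqxx ?orbT // negb_or ca.
  by apply: (@mem_neq_set _ a); rewrite ?set21.
pose e2 := sB s2.
have r1 : e1 \in replies sB s2 by rewrite !inE eqxx.
have r2 : e2 \in replies sB s2 by rewrite !inE eqxx orbT.
have E2 : e2 \in edges K by case: l2 => _; apply; rewrite mem_cat r2 orbT.
have ne : e1 != e2.
  by case: l2 => /=; rewrite !inE !negb_or -!andbA => /and5P[_ _ _ _ /and3P[]].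
have star2 e : e \in s2 -> a \in e.
  by rewrite !inE => /pred2P[] ->; rewrite !inE eqxx.
have sz2 : (size s2).*2 <= #|edges K| by apply: leq_trans six.
have [e|e|p star_p] := @isomorphic_star _ _ _ (line_iso symB l2 sz2) a.
- by rewrite inE => er; case: l2 => _; apply; rewrite mem_cat er orbT.
- by rewrite inE; apply: star2.
have p1 : p \in e1 by apply: star_p; rewrite inE.
have p2 : p \in e2 by apply: star_p; rewrite inE.
(* If [ap] is red, that is [p] is [b] or [c], the star phase starts at once; otherwise [e1] is
   [cp]. *)
have [ap|apN] := boolP ([set a; p] \in s2).
  exact: (linked_star_absurd l2 sz2 star2 ap r1 r2).
have pa : p != a by apply: e1_neq_a.
have pb : p != b by apply: contraNneq apN => ->; rewrite !inE eqxx.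
have pc : p != c by apply: contraNneq apN => ->; rewrite !inE eqxx orbT.
have def_e1 : e1 = [set c; p] by apply: edge_eq_set2; rewrite // eq_sym.
(* Since [p] lies on [e2], this asks whether [ap] is blue; if so, A closes the triangle with
   [bc]. *)
have [ae2|aN2] := boolP (a \in e2).
  have l3 : line sB (rcons s2 [set b; c]).
    apply: line_rcons => //; first by rewrite set2_edge eq_sym.
    rewrite /= !inE !negb_or; apply/and4P; split.
    - by apply: (@mem_neq_set _ c); rewrite !inE ?eqxx ?orbT // negb_or ca.
    - apply: (@mem_neq_set _ b); rewrite !inE ?eqxx //.
      by rewrite negb_or eq_sym ab eq_sym.
    - by rewrite eq_sym; apply: (@mem_neq_set _ p); rewrite // !inE negb_or pb.
    - rewrite eq_sym; apply: (@mem_neq_set _ a) => //.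
      by rewrite !inE negb_or ab eq_sym.
  have adj3 x y : @adj (subgraph [set e in rcons s2 [set b; c]]) x y =
      [&& x != y, x \in [set a; b; c] & y \in [set a; b; c]].
    rewrite /= /subgraph_adj /= /complete_adj; case: eqVneq => //= xy.
    rewrite inE; apply/idP/andP => [es|[xs ys]].
      suff /subsetP sub : [set x; y] \subset [set a; b; c].
        by rewrite !sub ?set21 ?set22.
      move: es; rewrite /= !inE => /or3P[] /eqP ->;
        by rewrite subUset !sub1set !inE !eqxx ?orbT.
    move: xs ys xy; rewrite !inE -!orbA => /or3P[] /eqP-> /or3P[] /eqP->;
      by rewrite ?eqxx // => _; rewrite ?eqxx ?orbT // setUC ?eqxx ?orbT.
  have adj_r x y : x != y -> [set x; y] \in replies sB s2 ->
      @adj (subgraph [set e in replies sB (rcons s2 [set b; c])]) x y.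
    move=> xy r; apply/andP; split=> //.
    by rewrite inE replies_rcons mem_rcons inE r orbT.
  have def_e2 : e2 = [set p; a] by apply: edge_eq_set2.
  (* Blue, like the red triangle, is a union of cliques, so its path [c p a] forces [ca] to be blue,
     though it is red. *)
  have : @adj (subgraph [set e in replies sB (rcons s2 [set b; c])]) c a.
    apply: (@isomorphic_cluster _ _ _ (line_iso symB l3 six) _ c p a) => //.
    - move=> x y z; rewrite !adj3 => -> /and3P[_ -> _] /and3P[_ _ ->] //.
    - by apply: adj_r; rewrite -?def_e1 // eq_sym.
    - by apply: adj_r; rewrite -?def_e2.
  rewrite /= /subgraph_adj inE => /andP[_ ca_blue].
  case: l3; rewrite cat_uniq => /and3P[_ /hasPn/(_ _ ca_blue)].
  by rewrite /= setUC !inE eqxx orbT.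
(* Neither [e1] nor [e2] contains [a], so [ap] is still free. *)
have ap3 : [set a; p] \notin s2 ++ replies sB s2.
  rewrite mem_cat negb_or apN !inE negb_or /=; apply/andP; split.
    by apply: (@mem_neq_set _ a); rewrite ?set21.
  by apply: (@mem_neq_set _ a); rewrite ?set21.
have l3 : line sB (rcons s2 [set a; p]).
  by apply: line_rcons => //; rewrite set2_edge eq_sym.
have r13 : e1 \in replies sB (rcons s2 [set a; p]).
  by rewrite replies_rcons mem_rcons inE r1 orbT.
have r23 : e2 \in replies sB (rcons s2 [set a; p]).
  by rewrite replies_rcons mem_rcons inE r2 orbT.
have star3 e : e \in rcons s2 [set a; p] -> a \in e.
  by rewrite mem_rcons inE => /predU1P[->|/star2]; rewrite ?set21.
have ap_red : [set a; p] \in rcons s2 [set a; p].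
  by rewrite mem_rcons inE eqxx.
exact: (linked_star_absurd l3 six star3 ap_red r13 r23 ne p1 p2).
Qed.

End CompleteGraph.

Theorem theorem5 (n : nat) : 4 <= n -> ~ Symm (complete_graph n).
Proof. by move=> n4 [sB symB]; apply: complete_not_symmetric n4 symB. Qed.
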